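(* Let $F$ be a finite field of cardinality $q$ and let $n \geq 2$ be an integer. Then $$W(\Gamma(M_n(F)))= |Z(M_n(F))|^2 - \frac{5}{2}|Z(M_n(F))|+\frac{3}{2} + \frac{1}{2} \sum_{k=1}^{n-1}\left(\left(\prod_{j=0}^{k-1}\frac{q^n-q^j}{q^k-q^j}\right)\left(\prod_{j=0}^{k-1}\left( q^{n-k}-q^j \right)-\left(2q^{n(n-k)}-q^{(n-k)^2}\right)\prod_{j=0}^{k-1}(q^n-q^j)\right)\right),$$ where $|Z(M_n(F))|=q^{n^2}-q^{\binom{n}{2}}\prod_{j=1}^{n}(q^{j}-1)$.
   Context: $M_n(F)$ is the ring of all $n\times n$ matrices with entries in $F$. For a finite ring $R$ (possibly non-commutative), $Z(R)=\{x \in R : \text{there exists } 0 \neq y \in R \text{ such that } xy=0 \text{ or } yx=0\}$ is the set of zero-divisors (so $0\in Z(R)$ for $R\ne 0$). The zero-divisor graph $\Gamma(R)$ is the undirected simple graph with vertex set $V(\Gamma(R))=Z(R)\setminus\{0\}$ in which two distinct vertices $x \neq y$ are joined by an edge if and only if $xy=0$ or $yx=0$. $d(u,v)$ denotes the distance (length of a shortest path) between vertices $u$ and $v$. The Wiener index of a graph $\Gamma$ is $W(\Gamma)=\frac12\sum_{u,v\in V(\Gamma)}d(u,v)$, the sum being over ordered pairs. *)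

(* Defs.v *)
From HB Require Import structures.
From mathcomp Require Import all_boot all_order all_algebra.

Set Implicit Arguments.
Unset Strict Implicit.
Unset Printing Implicit Defensive.

Import GRing.Theory.
Local Open Scope ring_scope.

(* Walks need not be simple, but a shortest one is. *)
Definition has_walk (T : finType) (e : rel T) (u v : T) (k : nat) : bool :=
  [exists p : k.-tuple T, path e u p && (last u p == v)].

(* The least length of a walk from u to v. A shortest path has length less
   than #|T|; the value is #|T| exactly when v is not reachable from u. *)
Definition dist (T : finType) (e : rel T) (u v : T) : nat :=
  find (has_walk e u v) (iota 0 #|T|).

Definition wiener_index (T : finType) (e : rel T) : rat :=
  2^-1 * \sum_(u : T) \sum_(v : T) (dist e u v)%:R.

(* Two-sided: left and right zero-divisors both count, and 0 is included as
   soon as R is nontrivial. *)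
Definition zero_divisors (R : finPzRingType) : {set R} :=
  [set x | [exists y : R, (y != 0) && ((x * y == 0) || (y * x == 0))]].

Definition zdg_vertex (R : finPzRingType) : finType :=
  {x : R | x \in zero_divisors R :\ 0}.

Definition zdg_edge (R : finPzRingType) : rel (zdg_vertex R) :=
  fun x y => (x != y) && ((val x * val y == 0) || (val y * val x == 0)).

(* The library declares the ring structure of 'M[F]_n for every n, but joins it
   with the finite type structure only for n of the form m.+1. *)
Definition matrix_ring (F : finFieldType) (n : nat) : finPzRingType :=
  HB.pack 'M[F]_n (GRing.PzRing.on 'M[F]_n) (Finite.on 'M[F]_n).

(* Main.v *)
(** If A and B are nonzero singular matrices, u spans a line in the right kernel
    of A and v a line in the left kernel of B, then C = u v is nonzero with
    A C = 0 and C B = 0: the graph has diameter at most 2, and its Wiener index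
    is N(N - 1) - E with N = |Z| - 1 vertices and E edges.  A matrix A of rank k
    has q^(n(n-k)) right annihilators, as many left ones, and q^((n-k)^2)
    two-sided ones; removing B = 0, and B = A when A^2 = 0, gives its degree.
    Matrices of rank k are counted through their factorizations A = C^T R with
    C and R row-free of height k, on which GL_k acts simply transitively; such
    an A squares to zero iff C R^T = 0, i.e. iff C lies in the (n-k)-dimensional
    kernel of R^T. *)

Require Import Defs.
From mathcomp Require Import all_boot all_order all_algebra.
From mathcomp Require Import ring.

Set Implicit Arguments.
Unset Strict Implicit.
Unset Printing Implicit Defensive.

Import Order.TTheory GRing.Theory Num.Theory.
Local Open Scope ring_scope.

Lemma natr_card_set (T : finType) (P : pred T) :
  #|[set x | P x]|%:R = \sum_(x | P x) 1 :> rat.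
Proof. by rewrite -sum1dep_card natr_sum. Qed.

(** * Row-free matrices and rank factorizations over a finite field *)

Section MatrixCounting.

Variable F : finFieldType.
Let q : rat := #|F|%:R.

(** Right multiplication by the row-free [row_base V] maps all matrices with [\rank V] columns
    bijectively onto these [M]. *)
Lemma card_submx m n p (V : 'M[F]_(p, n)) :
  #|[set M : 'M_(m, n) | (M <= V)%MS]| = (#|F| ^ (m * \rank V))%N.
Proof.
rewrite -card_mx -(card_imset _ (row_free_inj (row_base_free V))).
apply: eq_card => M; rewrite inE; apply/idP/imsetP.
  by rewrite -(eq_row_base V) => /submxP[X ->]; exists X.
by case=> X _ ->; rewrite (submx_trans (submxMl _ _)) // eq_row_base.
Qed.

Lemma row_free_col_mx_row k n (u : 'rV[F]_n) (M : 'M_(k, n)) :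
  row_free (col_mx u M) = row_free M && ~~ (u <= M)%MS.
Proof.
have rk : \rank (col_mx u M) = \rank (u + M)%MS by rewrite addsmxE.
rewrite /row_free rk; have [sub|nsub] := boolP (u <= M)%MS.
  rewrite andbF (addsmx_idPr sub); apply/negbTE.
  by rewrite neq_ltn ltnS rank_leq_row.
rewrite andbT.
have lt : (\rank M < \rank (u + M)%MS)%N.
  rewrite ltn_neqAle mxrankS ?addsmxSr // andbT.
  apply: contra nsub => /eqP e.
  by rewrite (submx_trans (addsmxSl u M)) // -(mxrank_leqif_sup (addsmxSr u M)).2 e.
have le : (\rank (u + M)%MS <= (\rank M).+1)%N.
  by rewrite (leq_trans (mxrank_adds_leqif u M)) // -[leqRHS]add1n leq_add2r rank_leq_row.
have -> : \rank (u + M)%MS = (\rank M).+1 by apply/eqP; rewrite eqn_leq le.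
by rewrite add1n eqSS.
Qed.

(** Rows are chosen one at a time, each in the row space of [V] but outside the span of the previous
    ones. For [k] beyond [\rank V] a factor vanishes and both sides are 0. *)
Lemma card_row_free_submx k n p (V : 'M[F]_(p, n)) :
  #|[set M : 'M_(k, n) | row_free M && (M <= V)%MS]|%:R
    = \prod_(0 <= j < k) (q ^+ \rank V - q ^+ j).
Proof.
elim: k => [|k IHk].
  rewrite big_nil; have -> : [set M : 'M_(0, n) | row_free M && (M <= V)%MS] = setT.
    by apply/setP=> M; rewrite !inE [M]flatmx0 /row_free mxrank0 sub0mx.
  by rewrite cardsT card_mx.
rewrite big_nat_recr //= -IHk -[k.+1]/(1 + k)%N -[in LHS]sum1_card natr_sum.
(* Fibre over the lower [k] rows [M]: the admissible top rows form [A :\: B], the row space of [V]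
   minus that of [M]. *)
rewrite (partition_big (dsubmx : 'M_(1 + k, n) -> _)
  (mem [set M : 'M_(k, n) | row_free M && (M <= V)%MS])) /=; last first.
  move=> M; rewrite -[M]vsubmxK !inE col_mxKd row_free_col_mx_row col_mx_sub.
  by case/andP=> /andP[-> _] /andP[].
rewrite -sumr_const mulr_suml; apply: eq_bigr => M; rewrite inE => /andP[Mfree MV].
rewrite mul1r -natr_sum sum1dep_card.
set A := [set u : 'rV_n | (u <= V)%MS]; set B := [set u : 'rV_n | (u <= M)%MS].
have -> : #|[set N : 'M_(1 + k, n) | (N \in [set M | row_free M && (M <= V)%MS])
     && (dsubmx N == M)]| = #|A :\: B|.
  rewrite -(card_imset (A :\: B) (f := fun u => col_mx u M)); last first.
    by move=> u v /eq_col_mx[].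
  apply: eq_card => N; rewrite !inE; apply/andP/imsetP.
    case=> /andP[Nfree NV] /eqP eqM; exists (usubmx N); last by rewrite -eqM vsubmxK.
    move: Nfree NV; rewrite -[N]vsubmxK row_free_col_mx_row col_mx_sub eqM col_mxKu.
    by rewrite !inE; case/andP=> _ -> /andP[].
  case=> u; rewrite !inE => /andP[nuM uV] ->.
  by rewrite row_free_col_mx_row col_mx_sub col_mxKd eqxx Mfree nuM uV MV.
rewrite cardsDS; last first.
  by apply/subsetP=> u; rewrite !inE => uM; rewrite (submx_trans uM).
rewrite natrB; last first.
  apply: subset_leq_card.
  by apply/subsetP=> u; rewrite !inE => uM; rewrite (submx_trans uM).
by rewrite !card_submx !mul1n !natrX (eqP Mfree).
Qed.

Lemma card_row_free k n :
  #|[set M : 'M[F]_(k, n) | row_free M]|%:R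
    = \prod_(0 <= j < k) (q ^+ n - q ^+ j).
Proof.
rewrite -[in RHS](mxrank1 F n) -card_row_free_submx.
by congr (_%:R); apply: eq_card => M; rewrite !inE submx1 andbT.
Qed.

(** The factorizations form one free orbit of the invertible [G]: [f] moves the base point given by
    [col_base A] and [row_base A]. *)
Lemma card_rank_factor m n (A : 'M[F]_(m, n)) :
  #|[set p : 'M[F]_(\rank A, m) * 'M[F]_(\rank A, n) |
       [&& row_free p.1, row_free p.2 & p.1^T *m p.2 == A]]|
    = #|[set G : 'M[F]_(\rank A) | row_free G]|.
Proof.
pose f (G : 'M[F]_(\rank A)) :=
  ((col_base A *m invmx G)^T, G *m row_base A).
have Rfree := row_base_free A.
rewrite -(card_in_imset (f := f)); last first.
  by move=> G H _ _ [_ /(row_free_inj Rfree)].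
apply: eq_card => -[C R]; rewrite inE /=; apply/and3P/imsetP.
  case=> Cf Rf /eqP CR.
  (* [A] factors through [R] and has the same rank, so the row spaces agree; this produces [G] with
     [R = G *m row_base A]. *)
  have eqR : (R == A)%MS.
    have AR : (A <= R)%MS by apply/submxP; exists C^T.
    by rewrite AR andbT -(mxrank_leqif_sup AR).2; move: Rf; rewrite /row_free eq_sym.
  have RE : R *m pinvmx (row_base A) *m row_base A = R.
    by rewrite mulmxKpV // eq_row_base; case/andP: eqR.
  set G := R *m pinvmx _ in RE.
  have Gf : row_free G.
    by rewrite /row_free eqn_leq rank_leq_row -{1}(eqP Rf) -RE mxrankM_maxl.
  exists G; rewrite ?inE // /f RE; congr (_, _).
  apply: trmx_inj; rewrite trmxK.
  apply: (row_free_inj Gf); rewrite /= mulmxKV -?row_free_unit //.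
  by apply: (row_free_inj Rfree); rewrite /= -mulmxA RE CR mulmx_base.
case=> G; rewrite inE => Gf [-> ->]; have Gu := Gf; rewrite row_free_unit in Gu.
split.
- rewrite /row_free mxrank_tr mxrankMfree ?row_free_unit ?unitmx_inv //.
  exact: col_base_full.
- by rewrite /row_free mxrankMfree.
- by rewrite trmxK mulmxA mulmxKV // mulmx_base.
Qed.

(** The weight [f] lets one identity serve two counts: the constant 1 for all matrices of rank [k],
    an indicator for those of square zero. *)
Lemma sum_rank_factor k m n (f : 'M[F]_(m, n) -> rat) :
  \sum_(C : 'M[F]_(k, m) | row_free C) \sum_(R : 'M[F]_(k, n) | row_free R)
      f (C^T *m R)
    = #|[set G : 'M[F]_k | row_free G]|%:R * \sum_(A | \rank A == k) f A.
Proof.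
rewrite pair_big /=.
rewrite (partition_big (fun p => p.1^T *m p.2) (fun A => \rank A == k)) /=; last first.
  case=> C R /= /andP[Cf Rf]; rewrite mxrankMfree // mxrank_tr; exact: Cf.
rewrite mulr_sumr; apply: eq_bigr => A /eqP rkA.
rewrite (eq_bigr (fun=> f A)) => [|p /andP[_ /eqP->] //].
rewrite sumr_const mulr_natl; congr (_ *+ _).
move: rkA => <-; rewrite -card_rank_factor.
by apply: eq_card => p; rewrite !inE andbA.
Qed.

(** * One-sided and two-sided annihilators *)

Lemma card_annihilated n p (A : 'M[F]_(n, p)) m :
  #|[set B : 'M[F]_(m, n) | B *m A == 0]| = (#|F| ^ (m * (n - \rank A)))%N.
Proof.
rewrite -mxrank_ker -card_submx; apply: eq_card => B.
by rewrite !inE; apply/eqP/sub_kermxP.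
Qed.

Lemma card_annihilated_tr n p (A : 'M[F]_(p, n)) m :
  #|[set B : 'M[F]_(n, m) | A *m B == 0]| = (#|F| ^ (m * (n - \rank A)))%N.
Proof.
rewrite -(mxrank_tr A) -card_annihilated -(card_imset _ (@trmx_inj _ _ _)).
apply: eq_card => B; rewrite !inE; apply/imsetP/eqP.
  by case=> X; rewrite inE => /eqP AX ->; rewrite -trmx_mul AX trmx0.
by move=> BA; exists B^T; rewrite ?trmxK // inE -[A]trmxK -trmx_mul BA trmx0.
Qed.

(** [B *m A = 0] means [B = X *m K] for a unique [X] with [n - \rank A] columns. As [K] is row-free,
    [A *m B = 0] then reduces to [A *m X = 0]. *)
Lemma card_bi_annihilated n (A : 'M[F]_n) :
  #|[set B : 'M[F]_n | (A *m B == 0) && (B *m A == 0)]|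
    = (#|F| ^ (n - \rank A) ^ 2)%N.
Proof.
set K := row_base (kermx A).
have rkK : (n - \rank A)%N = \rank (kermx A) by rewrite mxrank_ker.
rewrite expnS expn1 {1}rkK -(card_annihilated_tr A).
rewrite -(card_imset _ (row_free_inj (row_base_free (kermx A)))).
apply: eq_card => B; rewrite !inE; apply/andP/imsetP.
  case=> /eqP AB /eqP/sub_kermxP; rewrite -(eq_row_base (kermx A)) => /submxP[X eqB].
  exists X => //; rewrite inE; apply/eqP.
  by apply: (row_free_inj (row_base_free (kermx A))); rewrite /= -mulmxA -eqB mul0mx.
case=> X; rewrite inE => /eqP AX ->; rewrite mulmxA AX mul0mx eqxx; split=> //.
by apply/eqP/sub_kermxP; rewrite (submx_trans (submxMl _ _)) // eq_row_base.
Qed.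

(** * Numbers of matrices of given rank, of square zero, and invertible *)

Let gt1_q : 1 < q.
Proof. by rewrite ltr1n card_finNzRing_gt1. Qed.

Lemma prod_qpow_sub_neq0 n k : (k <= n)%N ->
  \prod_(0 <= j < k) (q ^+ n - q ^+ j) != 0.
Proof.
move=> le_kn; rewrite big_nat_cond; apply: (big_ind (fun x => x != 0)) => //.
  exact: mulf_neq0.
move=> j /andP[lt_jk _]; rewrite subr_eq0 (inj_eq (ieexprIn _ _)) ?gt_eqF //.
- exact: leq_trans lt_jk _.
- exact: lt_trans gt1_q.
Qed.

(** The order of GL_k stays on the left as a factor, so no division occurs before the final
    computation. *)
Lemma card_rank_eq k m n :
  #|[set A : 'M[F]_(m, n) | \rank A == k]|%:R
      * \prod_(0 <= j < k) (q ^+ k - q ^+ j)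
    = \prod_(0 <= j < k) (q ^+ m - q ^+ j)
      * \prod_(0 <= j < k) (q ^+ n - q ^+ j).
Proof.
rewrite mulrC -!card_row_free [X in _ * X]natr_card_set -sum_rank_factor !natr_card_set mulr_suml.
by apply: eq_bigr => C _; rewrite mul1r.
Qed.

Lemma card_rank_eq_square0 k n :
  #|[set A : 'M[F]_n | (\rank A == k) && (A *m A == 0)]|%:R
      * \prod_(0 <= j < k) (q ^+ k - q ^+ j)
    = \prod_(0 <= j < k) (q ^+ n - q ^+ j)
      * \prod_(0 <= j < k) (q ^+ (n - k) - q ^+ j).
Proof.
rewrite -(card_row_free k k) -(card_row_free k n) mulrC.
rewrite [X in _ * X]natr_card_set big_mkcondr /=.
rewrite -(sum_rank_factor _ (fun A => if A *m A == 0 then 1 else 0)).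
(* [R] becomes the outer variable, so that for fixed [R] the admissible [C] are row-free matrices
   inside a fixed kernel. *)
rewrite exchange_big [X in _ = X * _]natr_card_set mulr_suml /=.
apply: eq_bigr => R Rfree; rewrite mul1r.
have -> : (n - k)%N = \rank (kermx R^T).
  by rewrite mxrank_ker mxrank_tr (eqP Rfree).
rewrite -card_row_free_submx natr_card_set [RHS]big_mkcondr.
apply: eq_bigr => C Cfree; congr (if _ then _ else _).
have -> : C^T *m R *m (C^T *m R) = C^T *m (C *m R^T)^T *m R.
  by rewrite trmx_mul trmxK !mulmxA.
(* Row-freeness cancels [R] on the right and, after transposition, [C^T] on the left. *)
apply/eqP/sub_kermxP => [CRC | ->]; last by rewrite trmx0 mulmx0 mul0mx.
apply: trmx_inj; rewrite trmx0; apply: trmx_inj; rewrite trmx0.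
apply: (row_free_inj Cfree); apply: trmx_inj; rewrite /= mul0mx trmx0 trmx_mul trmxK.
by apply: (row_free_inj Rfree); rewrite /= mul0mx.
Qed.

Lemma card_unitmx n :
  #|[set A : 'M[F]_n | A \in unitmx]|%:R
    = q ^+ 'C(n, 2) * \prod_(1 <= j < n.+1) (q ^+ j - 1).
Proof.
transitivity (\prod_(0 <= j < n) (q ^+ n - q ^+ j)).
  rewrite -card_row_free; congr (_%:R).
  by apply: eq_card => A; rewrite !inE row_free_unit.
(* Factor q^n - q^j as q^j (q^(n-j) - 1): the exponents j add up to ['C(n, 2)], and the other
   factors appear in reverse order. *)
rewrite -bin2_sum expr_sum [in RHS]big_add1 /= [X in _ * X]big_nat_rev /= -big_split /=.
apply: eq_big_nat => j /= lt_jn.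
by rewrite add0n subnSK // mulrBr mulr1 -exprD subnKC // ltnW.
Qed.

Lemma sum_rank n (g : 'M[F]_n -> rat) :
  \sum_(A : 'M[F]_n | (A != 0) && (\rank A < n)%N) g A
    = \sum_(1 <= k < n) \sum_(A | \rank A == k) g A.
Proof.
under [RHS]eq_bigr do rewrite big_mkcond /=.
rewrite exchange_big big_mkcond /=; apply: eq_bigr => A _.
by rewrite -big_mkcond; under eq_bigl do rewrite eq_sym;
   rewrite big_nat1_eq lt0n mxrank_eq0.
Qed.

(** * Zero-divisors as singular matrices, and their common annihilators *)

Lemma zero_divisorsE n (A : 'M[F]_n) : (0 < n)%N ->
  (A \in zero_divisors (matrix_ring F n)) = (\rank A < n)%N.
Proof.
move=> n_gt0; rewrite inE; apply/existsP/idP => [[B /andP[nzB AB]]|lt_An].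
  rewrite ltn_neqAle rank_leq_row andbT; apply: contra nzB => Afull.
  have Aunit : A \in unitmx by rewrite -row_free_unit.
  case/orP: AB => /eqP AB; apply/eqP.
    by rewrite -(mulKmx Aunit B) [A *m B]AB mulmx0.
  by rewrite -(mulmxK Aunit B) [B *m A]AB mul0mx.
exists (kermx A); apply/andP; split.
  by rewrite -[_ == _]/(kermx A == 0) -mxrank_eq0 mxrank_ker -lt0n subn_gt0.
by apply/orP; right; apply/eqP; exact: mulmx_ker.
Qed.

Lemma exists_common_annihilator n (A B : 'M[F]_n) :
  (\rank A < n)%N -> (\rank B < n)%N ->
  exists C : 'M[F]_n, [/\ C != 0, A *m C = 0 & C *m B = 0].
Proof.
(* [kermx] is a left kernel, so the right kernel of [A] is reached through [A^T]. *)
move=> ltA ltB; pose u := nz_row (kermx A^T); pose v := nz_row (kermx B).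
have nzu : u != 0 by rewrite nz_row_eq0 -mxrank_eq0 mxrank_ker mxrank_tr -lt0n subn_gt0.
have nzv : v != 0 by rewrite nz_row_eq0 -mxrank_eq0 mxrank_ker -lt0n subn_gt0.
exists (u^T *m v); split.
- apply: contra nzu => /eqP uv; apply/eqP/trmx_inj; rewrite trmx0.
  have vfree : row_free v by rewrite /row_free rank_rV nzv.
  by apply: (row_free_inj vfree); rewrite /= uv mul0mx.
- rewrite mulmxA -[A]trmxK -trmx_mul.
  by have /sub_kermxP-> := nz_row_sub (kermx A^T); rewrite trmx0 mul0mx.
- by rewrite -mulmxA; have /sub_kermxP-> := nz_row_sub (kermx B); rewrite mulmx0.
Qed.

End MatrixCounting.

(** * Distances in a graph of diameter at most two *)

Lemma dist_diameter2 (T : finType) (e : rel T) (u v : T) :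
  (u != v -> ~~ e u v -> exists w, e u w && e w v) ->
  dist e u v = (if u == v then 0 else if e u v then 1 else 2)%N.
Proof.
have walk0 : has_walk e u v 0 = (u == v).
  apply/existsP/idP => [[p]|uv]; first by rewrite [p]tuple0 => /andP[].
  by exists [tuple].
have walk1 : has_walk e u v 1 = e u v.
  apply/existsP/idP => [[p]|uv].
    by case/tupleP: p => w p; rewrite [p]tuple0 /= andbT => /andP[? /eqP<-].
  by exists [tuple v]; rewrite /= uv eqxx.
move=> mid; rewrite /dist.
have : (0 < #|T|)%N by apply/card_gt0P; exists u.
case: eqVneq mid walk0 => [-> _ walk0|neq_uv mid walk0].
  by case: #|T| => //= N _; rewrite walk0.
have : (1 < #|T|)%N by apply/card_gt1P; exists u, v.
case: #|T| => [|[|N]] //= _ _; rewrite walk0 walk1.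
case: ifPn => // /(mid isT)[w /andP[uw wv]].
(* If [#|T|] is 2, the list of lengths is exhausted and [find] returns its size, again 2. *)
case: N => //= N; have -> : has_walk e u v 2 = true; last by [].
by apply/existsP; exists [tuple w; v]; rewrite /= uw wv eqxx.
Qed.

(** * Distances, degrees and order of the zero-divisor graph *)

Section ZeroDivisorGraph.

Variables (F : finFieldType) (n : nat).
Hypothesis n_ge2 : (2 <= n)%N.
Let q : rat := #|F|%:R.

Let zdg_vertexE (A : 'M[F]_n) :
  (A \in zero_divisors (matrix_ring F n) :\ 0) = (A != 0) && (\rank A < n)%N.
Proof. by rewrite in_setD1 zero_divisorsE // ltnW. Qed.

(** This linear form splits the distance sum into a count of pairs and a sum of degrees. *)
Lemma dist_zdg (x y : zdg_vertex (matrix_ring F n)) :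
  (dist (@zdg_edge (matrix_ring F n)) x y)%:R
    = 2 * (x != y)%:R - (zdg_edge x y)%:R :> rat.
Proof.
rewrite dist_diameter2.
  by rewrite /zdg_edge; case: eqVneq => //= _; case: ifP.
move=> neq_xy; rewrite /zdg_edge neq_xy /= negb_or => /andP[xy yx].
have := valP x; rewrite [_ \in _]zdg_vertexE => /andP[nzx ltx].
have := valP y; rewrite [_ \in _]zdg_vertexE => /andP[nzy lty].
have [C [nzC xC Cy]] := exists_common_annihilator ltx lty.
have Cvert : (C : matrix_ring F n) \in zero_divisors (matrix_ring F n) :\ 0.
  rewrite zdg_vertexE nzC ltn_neqAle rank_leq_row andbT.
  apply: contra nzx => Cfree; apply/eqP.
  have Cunit : C \in unitmx by rewrite -row_free_unit.
  by rewrite -(mulmxK Cunit (val x)) xC mul0mx.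
exists (Sub C Cvert : zdg_vertex (matrix_ring F n)).
have xC' : val x * (C : matrix_ring F n) == 0 by apply/eqP.
have Cy' : (C : matrix_ring F n) * val y == 0 by apply/eqP.
(* [C] differs from [x] and from [y], since either equality would give [val x * val y = 0]. *)
rewrite SubK xC' Cy' !andbT; apply/andP; split.
  by apply: contraNneq xy => ->; rewrite SubK.
by apply: contraNneq xy => <-; rewrite SubK.
Qed.

Lemma degree_zdg (A : 'M[F]_n) : A != 0 -> (\rank A < n)%N ->
  \sum_(B : 'M[F]_n | (B != 0) && (\rank B < n)%N)
      ((A != B) && ((A *m B == 0) || (B *m A == 0)))%:R
    = 2 * q ^+ (n * (n - \rank A)) - q ^+ ((n - \rank A) ^ 2) - 1
      - (A *m A == 0)%:R :> rat.
Proof.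
move=> nzA ltA.
(* An annihilator of the nonzero [A] is singular, so the sum can be extended to all [B]. *)
have annih (B : 'M[F]_n) : (A *m B == 0) || (B *m A == 0) -> (\rank B < n)%N.
  move=> AB; rewrite ltn_neqAle rank_leq_row andbT.
  apply: contra nzA => Bfree; have Bunit : B \in unitmx by rewrite -row_free_unit.
  case/orP: AB => /eqP AB; apply/eqP.
    by rewrite -(mulmxK Bunit A) AB mul0mx.
  by rewrite -(mulKmx Bunit A) AB mulmx0.
pose r (b : bool) : rat := b%:R.
(* Inclusion-exclusion over the two sides, with [B = 0] and a self-annihilating [B = A] taken
   out. *)
transitivity (\sum_(B : 'M[F]_n) (r (A *m B == 0) + r (B *m A == 0)
    - r ((A *m B == 0) && (B *m A == 0)) - r (B == 0)
    - r ((B == A) && (A *m A == 0)))).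
  rewrite big_mkcond; apply: eq_bigr => B _; rewrite /r [B == A]eq_sym.
  case: (eqVneq B 0) => [->|nzB] /=.
    by rewrite mulmx0 mul0mx eqxx (negPf nzA) /=; ring.
  case: (eqVneq A B) => [<-|neqAB] /=.
    by rewrite ltA; case: eqP => _ /=; ring.
  case: ifP => [_|/negbT nltB].
    by case: eqP => _; case: eqP => _ /=; ring.
  have : ~~ ((A *m B == 0) || (B *m A == 0)) by apply: contra nltB => /annih.
  by rewrite negb_or => /andP[/negPf-> /negPf->] /=; ring.
have sumr_r (P : pred 'M[F]_n) : \sum_B r (P B) = #|[set B | P B]|%:R.
  by rewrite natr_card_set [RHS]big_mkcond; apply: eq_bigr => B _; rewrite /r; case: (P B).
rewrite !sumrB big_split /= !sumr_r.
rewrite card_annihilated card_annihilated_tr card_bi_annihilated.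
have -> : [set B : 'M[F]_n | B == 0] = [set 0] by apply/setP=> B; rewrite !inE.
have -> : #|[set B | (B == A) && (A *m A == 0)]| = (A *m A == 0) :> nat.
  case: eqP => _; last by rewrite /= -(cards0 'M[F]_n); apply: eq_card => B; rewrite !inE andbF.
  by rewrite /= -(cards1 A); apply: eq_card => B; rewrite !inE andbT.
by rewrite cards1 !natrX -/q; ring.
Qed.

Lemma card_zdg_vertex :
  #|zdg_vertex (matrix_ring F n)|%:R = #|zero_divisors (matrix_ring F n)|%:R - 1 :> rat.
Proof.
rewrite card_sig (cardsD1 0 (zero_divisors (matrix_ring F n))).
have -> : 0 \in zero_divisors (matrix_ring F n).
  by rewrite [_ \in _]zero_divisorsE ?mxrank0 // ltnW.
by rewrite natrD [in RHS]addrC addKr; congr (_%:R).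
Qed.

Lemma sum_dist_zdg :
  \sum_(x : zdg_vertex (matrix_ring F n)) \sum_(y : zdg_vertex (matrix_ring F n))
      (dist (@zdg_edge (matrix_ring F n)) x y)%:R
    = 2 * #|zdg_vertex (matrix_ring F n)|%:R * (#|zdg_vertex (matrix_ring F n)|%:R - 1)
      - \sum_(A : 'M[F]_n | (A != 0) && (\rank A < n)%N)
          (2 * q ^+ (n * (n - \rank A)) - q ^+ ((n - \rank A) ^ 2) - 1
            - (A *m A == 0)%:R) :> rat.
Proof.
under eq_bigr do under eq_bigr do rewrite dist_zdg.
under eq_bigr do rewrite sumrB -mulr_sumr.
rewrite sumrB; congr (_ - _).
  have sum_neq (T : finType) (x : T) : \sum_y (x != y)%:R = #|T|%:R - 1 :> rat.
    rewrite (bigD1 x) //= eqxx add0r (eq_bigr (fun=> 1)); last first.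
      by move=> y; rewrite eq_sym => ->.
    rewrite sumr_const cardC1 -subn1 natrB //.
    by apply/card_gt0P; exists x.
  by under eq_bigr do rewrite sum_neq; rewrite sumr_const -mulr_natl; ring.
pose V := zero_divisors (matrix_ring F n) :\ 0.
(* Passing from the vertex subtype to matrices makes the inner sum a degree. *)
transitivity (\sum_(A in V) \sum_(B in V)
   ((A != B) && ((A *m B == 0) || (B *m A == 0)))%:R : rat).
  rewrite [RHS]big_sub; apply: eq_bigr => x _.
  by rewrite [RHS]big_sub; apply: eq_bigr.
apply: eq_big => [A|A]; first by rewrite -zdg_vertexE.
rewrite [_ \in _]zdg_vertexE => /andP[nzA ltA].
by rewrite -degree_zdg //; apply: eq_bigl => B; rewrite -zdg_vertexE.
Qed.

Lemma card_zero_divisors :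
  #|zero_divisors (matrix_ring F n)|%:R
    = q ^+ (n ^ 2) - q ^+ 'C(n, 2) * \prod_(1 <= j < n.+1) (q ^+ j - 1) :> rat.
Proof.
rewrite -card_unitmx; apply/eqP; rewrite eq_sym subr_eq -natrD -natrX; apply/eqP.
congr (_%:R); rewrite expnS expn1 -card_mx -(cardsC [set A : 'M[F]_n | A \in unitmx]) addnC.
congr (_ + _)%N; apply: eq_card => A; rewrite [RHS]zero_divisorsE; last exact: ltnW.
by rewrite !inE -row_free_unit ltn_neqAle rank_leq_row andbT.
Qed.

End ZeroDivisorGraph.

(** * Assembly of the Wiener index from degrees and rank counts *)

Theorem theorem1 (F : finFieldType) (n : nat) (hn : (2 <= n)%N) :
  let q : rat := #|F|%:R in
  let z : rat := #|zero_divisors (matrix_ring F n)|%:R in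
  z = q ^+ (n ^ 2) - q ^+ 'C(n, 2) * \prod_(1 <= j < n.+1) (q ^+ j - 1)
  /\
  wiener_index (@zdg_edge (matrix_ring F n)) =
    z ^+ 2 - 5 / 2 * z + 3 / 2
    + 1 / 2 * \sum_(1 <= k < n)
        ((\prod_(0 <= j < k) ((q ^+ n - q ^+ j) / (q ^+ k - q ^+ j)))
         * ((\prod_(0 <= j < k) (q ^+ (n - k) - q ^+ j))
            - (2 * q ^+ (n * (n - k)) - q ^+ ((n - k) ^ 2))
              * (\prod_(0 <= j < k) (q ^+ n - q ^+ j)))).
Proof.
move=> q z; split; first exact: card_zero_divisors.
rewrite /wiener_index sum_dist_zdg // card_zdg_vertex // -/z -/q.
(* The summand -1 of each degree is split off. It contributes z - 1 in total, and half of 2(z - 1)(z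
   - 2) + (z - 1) is the polynomial part of the formula. *)
under [X in _ - X]eq_bigr do rewrite addrAC.
rewrite sumrB.
have -> : \sum_(A : 'M[F]_n | (A != 0) && (\rank A < n)%N) 1 = z - 1.
  rewrite -card_zdg_vertex // card_sig -[in RHS]sum1_card natr_sum.
  apply: eq_big => // A.
  by rewrite [RHS]in_setD1 zero_divisorsE // ltnW.
rewrite sum_rank.
set S := \sum_(1 <= k < n) _; set S' := \sum_(1 <= k < n) _.
suff -> : S = - S' by field.
rewrite /S /S' -sumrN; apply: eq_big_nat => k /andP[_ /ltnW le_kn].
set c : rat := 2 * q ^+ (n * (n - k)) - q ^+ ((n - k) ^ 2).
have -> : \sum_(A : 'M[F]_n | \rank A == k)
    (2 * q ^+ (n * (n - \rank A)) - q ^+ ((n - \rank A) ^ 2) - (A *m A == 0)%:R)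
  = c * #|[set A : 'M[F]_n | \rank A == k]|%:R
    - #|[set A : 'M[F]_n | (\rank A == k) && (A *m A == 0)]|%:R.
  rewrite !natr_card_set mulr_sumr big_mkcondr -sumrB; apply: eq_bigr => A /eqP->.
  by rewrite mulr1; case: (_ == _).
have nz : \prod_(0 <= j < k) (q ^+ k - q ^+ j) != 0 by exact: prod_qpow_sub_neq0.
(* Multiplying by the order of GL_k brings both counts into the form in which they were proved. *)
apply: (mulIf nz); rewrite mulrBl -mulrA card_rank_eq card_rank_eq_square0.
by rewrite prodf_div; field.
Qed.
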